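(* Let $\overline{\mathbf{E}}_0,\overline{\mathbf{E}}_1,\overline{\mathbf{E}}_2,\overline{\mathbf{M}},\mathbf{R}_1,\mathbf{R}_2\in\mathbb{C}^{n\times n}$, let $\omega,\kappa_1,\kappa_2$ be given constants ($\omega$ real, $\kappa_1,\kappa_2$ complex), and let $\mathrm{i}$ be the imaginary unit. Suppose $(k,\boldsymbol{\phi})$, with $k\in\mathbb{C}$ and $\boldsymbol{\phi}\in\mathbb{C}^n$, $\boldsymbol{\phi}\neq\mathbf{0}$, is a solution of the nonlinear eigenvalue problem $$\left(-k^2\,\overline{\mathbf{E}}_0+\mathrm{i}k\,\overline{\mathbf{E}}_1-\overline{\mathbf{E}}_2+\omega^2\,\overline{\mathbf{M}}+\mathbf{R}(k)\right)\boldsymbol{\phi}=\mathbf{0},\qquad \mathbf{R}(k)=\mathrm{i}\kappa_{y,1}\,\mathbf{R}_1+\mathrm{i}\kappa_{y,2}\,\mathbf{R}_2,$$ where $$\kappa_{y,1}:=\sqrt{\kappa_1^2-k^2},\qquad \kappa_{y,2}:=\sqrt{\kappa_2^2-k^2}.$$ Set $\xi_0:=-k^2$. Then the parameters $(\mathrm{i}k,\ \mathrm{i}\kappa_{y,1},\ \mathrm{i}\kappa_{y,2},\ \xi_0)$ form a solution (eigenvalue) of the four-parameter eigenvalue problem $$\left(-\overline{\mathbf{E}}_2+\omega^2\,\overline{\mathbf{M}}+\mathrm{i}k\,\overline{\mathbf{E}}_1+\mathrm{i}\kappa_{y,1}\mathbf{R}_1+\mathrm{i}\kappa_{y,2}\mathbf{R}_2+\xi_0\,\overline{\mathbf{E}}_0\right)\boldsymbol{\phi}=\mathbf{0},$$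 $$\left(\begin{bmatrix}0&-\kappa_1^2\\1&0\end{bmatrix}+\mathrm{i}\kappa_{y,1}\begin{bmatrix}1&0\\0&1\end{bmatrix}+\xi_0\begin{bmatrix}0&-1\\0&0\end{bmatrix}\right)\mathbf{x}_1=\mathbf{0},$$ $$\left(\begin{bmatrix}0&-\kappa_2^2\\1&0\end{bmatrix}+\mathrm{i}\kappa_{y,2}\begin{bmatrix}1&0\\0&1\end{bmatrix}+\xi_0\begin{bmatrix}0&-1\\0&0\end{bmatrix}\right)\mathbf{x}_2=\mathbf{0},$$ $$\left(\begin{bmatrix}0&0\\0&1\end{bmatrix}+\mathrm{i}k\begin{bmatrix}0&1\\1&0\end{bmatrix}+\xi_0\begin{bmatrix}1&0\\0&0\end{bmatrix}\right)\mathbf{x}_3=\mathbf{0},$$ that is, the first equation holds with the given $\boldsymbol{\phi}$, and there exist vectors $\mathbf{x}_1,\mathbf{x}_2,\mathbf{x}_3\in\mathbb{C}^2$ with $\mathbf{x}_1\neq\mathbf{0}$, $\mathbf{x}_2\neq\mathbf{0}$, $\mathbf{x}_3\neq\mathbf{0}$ satisfying the remaining three equations.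
   Context: An $r$-parameter eigenvalue problem is a system $(\mathbf{A}_{i0}+\lambda_1\mathbf{A}_{i1}+\cdots+\lambda_r\mathbf{A}_{ir})\,\mathbf{x}_i=\mathbf{0}$, $i=1,\ldots,r$, where $\mathbf{A}_{ij}$ are given $n_i\times n_i$ matrices. A tuple $(\lambda_1,\ldots,\lambda_r)\in\mathbb{C}^r$ is a solution (eigenvalue) if there exist nonzero vectors $\mathbf{x}_i$, $i=1,\ldots,r$, such that all $r$ equations are satisfied. In the four-parameter problem of the claim, $r=4$, the parameters are $\lambda_1=\mathrm{i}k$, $\lambda_2=\mathrm{i}\kappa_{y,1}$, $\lambda_3=\mathrm{i}\kappa_{y,2}$, $\lambda_4=\xi_0$, and the vectors are $\boldsymbol{\phi},\mathbf{x}_1,\mathbf{x}_2,\mathbf{x}_3$. The square roots denote a choice of complex square root (either sign is allowed), and the same values $\kappa_{y,1},\kappa_{y,2}$ are used in $\mathbf{R}(k)$ and in the four-parameter problem. Origin of the data: the matrices $\overline{\mathbf{E}}_0,\overline{\mathbf{E}}_1,\overline{\mathbf{E}}_2,\overline{\mathbf{M}},\mathbf{R}_1,\mathbf{R}_2$ are finite-element and coupling matrices of an elastic plate in contact with two fluid half-spaces; $\omega$ is the fixed frequency, $k$ the horizontal wavenumber, and $\kappa_1,\kappa_2$ the wavenumbers in the two fluids. *)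

(* Defs.v *)
From mathcomp Require Import all_boot all_order all_algebra.
From mathcomp Require Import reals complex.

Set Implicit Arguments.
Unset Strict Implicit.
Unset Printing Implicit Defensive.

Import GRing.Theory.
Local Open Scope ring_scope.

Definition mx22 (F : fieldType) (a b c d : F) : 'M[F]_2 :=
  \matrix_(i < 2, j < 2)
    if i == 0 then (if j == 0 then a else b) else (if j == 0 then c else d).

(* One equation (A_0 + l_1 A_1 + ... + l_r A_r) x = 0. The size is bundled
   because it may differ from one equation of the system to the next.        *)
Record pencil (F : fieldType) (r : nat) := Pencil {
  pencil_size : nat;
  pencil_coef : r.+1.-tuple 'M[F]_pencil_size
}.

Definition pencil_mx (F : fieldType) (r : nat) (A : pencil F r)
    (lam : r.-tuple F) : 'M[F]_(pencil_size A) :=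
  tnth (pencil_coef A) ord0
  + \sum_(j < r) tnth lam j *: tnth (pencil_coef A) (lift ord0 j).

Definition multiparam_eigenvalue (F : fieldType) (r : nat)
    (A : r.-tuple (pencil F r)) (lam : r.-tuple F) : Prop :=
  exists x : forall i : 'I_r, 'cV[F]_(pencil_size (tnth A i)),
    forall i : 'I_r, x i != 0 /\ pencil_mx (tnth A i) lam *m x i = 0.

(* The parameters are, in order, i k, i kappa_{y,1}, i kappa_{y,2}, xi_0. *)
Definition plate_problem (F : fieldType) (n : nat)
    (E0 E1 E2 M R1 R2 : 'M[F]_n) (omega kappa1 kappa2 : F) :
    4.-tuple (pencil F 4) :=
  [tuple
    Pencil [tuple - E2 + omega ^+ 2 *: M; E1; R1; R2; E0];
    Pencil [tuple mx22 0 (- kappa1 ^+ 2) 1 0; 0; mx22 1 0 0 1; 0;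
                  mx22 0 (-1) 0 0];
    Pencil [tuple mx22 0 (- kappa2 ^+ 2) 1 0; 0; 0; mx22 1 0 0 1;
                  mx22 0 (-1) 0 0];
    Pencil [tuple mx22 0 0 0 1; mx22 0 1 1 0; 0; 0; mx22 1 0 0 0]].

(* Main.v *)
Require Import Defs.
From mathcomp Require Import all_boot all_order all_algebra.
From mathcomp Require Import reals complex.
From mathcomp Require Import ring.

(* The 2 x 2 pencils have determinants kappa_j^2 - kappa_{y,j}^2 + xi_0 and
   xi_0 - (i k)^2, which vanish when xi_0 = - k^2; the vectors
   (- i kappa_{y,j}, 1) and (1, - i k) lie in their kernels. *)

Set Implicit Arguments.
Unset Strict Implicit.
Unset Printing Implicit Defensive.

Import GRing.Theory.
Local Open Scope ring_scope.
Local Open Scope complex_scope.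

Definition col2 (F : fieldType) (a b : F) : 'cV[F]_2 :=
  \col_(i < 2) if i == 0 then a else b.

Lemma col2_neq0 (F : fieldType) (a b : F) :
  (a != 0) || (b != 0) -> col2 a b != 0.
Proof.
move=> ab_neq0; apply: contraTneq ab_neq0 => /colP ab0.
have := ab0 0; have := ab0 1; rewrite !mxE /= => -> ->.
by rewrite eqxx.
Qed.

Lemma mx22D (F : fieldType) (a b c d a' b' c' d' : F) :
  mx22 a b c d + mx22 a' b' c' d' = mx22 (a + a') (b + b') (c + c') (d + d').
Proof. by apply/matrixP=> i j; rewrite !mxE; do 2!case: ifP. Qed.

Lemma mx22Z (F : fieldType) (l a b c d : F) :
  l *: mx22 a b c d = mx22 (l * a) (l * b) (l * c) (l * d).
Proof. by apply/matrixP=> i j; rewrite !mxE; do 2!case: ifP. Qed.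

Lemma mul_mx22_col2 (F : fieldType) (a b c d u v : F) :
  mx22 a b c d *m col2 u v = col2 (a * u + b * v) (c * u + d * v).
Proof.
by apply/colP=> i; rewrite !mxE !big_ord_recl big_ord0 addr0 !mxE /=; case: ifP.
Qed.

Lemma col2_0 (F : fieldType) : col2 0 0 = 0 :> 'cV[F]_2.
Proof. by apply/colP=> i; rewrite !mxE; case: ifP. Qed.

(** The sum has rows [(mu, - kappa ^+ 2 - xi)] and [(1, mu)]. The second row forces the direction
    [(- mu, 1)]; the first then gives [- mu ^+ 2 - kappa ^+ 2 - xi], zero by hypothesis. *)
Lemma sqrt_pencil_ker (F : fieldType) (kappa mu xi : F) :
  mu ^+ 2 = - (kappa ^+ 2 + xi) ->
  (mx22 0 (- kappa ^+ 2) 1 0 + mu *: mx22 1 0 0 1 + xi *: mx22 0 (-1) 0 0)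
    *m col2 (- mu) 1 = 0.
Proof.
move=> mu2; rewrite !mx22Z !mx22D mul_mx22_col2 -col2_0.
by congr col2; [ring: mu2 | ring].
Qed.

(** The sum has rows [(xi, mu)] and [(mu, 1)]: the second row kills [(1, - mu)], and the first gives
    [xi - mu ^+ 2]. *)
Lemma square_pencil_ker (F : fieldType) (mu xi : F) :
  xi = mu ^+ 2 ->
  (mx22 0 0 0 1 + mu *: mx22 0 1 1 0 + xi *: mx22 1 0 0 0)
    *m col2 1 (- mu) = 0.
Proof.
move=> ->; rewrite !mx22Z !mx22D mul_mx22_col2 -col2_0.
by congr col2; ring.
Qed.

(** Each root is given by its square alone, so either sign is allowed. [multiparam_eigenvalue] hides
    all four vectors; the other conjuncts fix [phi] in the first equation. *)
Theorem theorem1 (R : realType) (n : nat)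
    (E0 E1 E2 M R1 R2 : 'M[R[i]]_n)
    (omega : R) (kappa1 kappa2 : R[i])
    (k kappay1 kappay2 : R[i])
    (kappay1_sqrt : kappay1 ^+ 2 = kappa1 ^+ 2 - k ^+ 2)
    (kappay2_sqrt : kappay2 ^+ 2 = kappa2 ^+ 2 - k ^+ 2)
    (phi : 'cV[R[i]]_n) (phi_neq0 : phi != 0)
    (nlevp : (- k ^+ 2 *: E0 + ('i%C * k) *: E1 - E2 + (omega%:C) ^+ 2 *: M
              + (('i%C * kappay1) *: R1 + ('i%C * kappay2) *: R2)) *m phi = 0)
    (xi0 : R[i]) (xi0_def : xi0 = - k ^+ 2) :
  multiparam_eigenvalue
    (plate_problem E0 E1 E2 M R1 R2 omega%:C kappa1 kappa2)
    [tuple 'i%C * k; 'i%C * kappay1; 'i%C * kappay2; xi0]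
  /\ (- E2 + (omega%:C) ^+ 2 *: M + ('i%C * k) *: E1 + ('i%C * kappay1) *: R1
        + ('i%C * kappay2) *: R2 + xi0 *: E0) *m phi = 0
  /\ exists x1 x2 x3 : 'cV[R[i]]_2,
      [/\ x1 != 0, x2 != 0 & x3 != 0] /\
      [/\ (mx22 0 (- kappa1 ^+ 2) 1 0 + ('i%C * kappay1) *: mx22 1 0 0 1
             + xi0 *: mx22 0 (-1) 0 0) *m x1 = 0,
          (mx22 0 (- kappa2 ^+ 2) 1 0 + ('i%C * kappay2) *: mx22 1 0 0 1
             + xi0 *: mx22 0 (-1) 0 0) *m x2 = 0
        & (mx22 0 0 0 1 + ('i%C * k) *: mx22 0 1 1 0
             + xi0 *: mx22 1 0 0 0) *m x3 = 0].
Proof.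
have sqr_iM (z : R[i]) : ('i%C * z) ^+ 2 = - z ^+ 2.
  by rewrite exprMn sqr_i mulN1r.
have ker0 : (- E2 + (omega%:C) ^+ 2 *: M + ('i%C * k) *: E1
    + ('i%C * kappay1) *: R1 + ('i%C * kappay2) *: R2 + xi0 *: E0) *m phi = 0.
  rewrite -nlevp xi0_def; congr (_ *m _).
  (* The same six summands occur on both sides; the permutation moves the [E0] and [E1] terms to the
     front. *)
  by rewrite [RHS]addrA [LHS](ACl (6*3*1*2*4*5)).
have /sqrt_pencil_ker ker1 : ('i%C * kappay1) ^+ 2 = - (kappa1 ^+ 2 + xi0).
  by rewrite sqr_iM kappay1_sqrt xi0_def.
have /sqrt_pencil_ker ker2 : ('i%C * kappay2) ^+ 2 = - (kappa2 ^+ 2 + xi0).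
  by rewrite sqr_iM kappay2_sqrt xi0_def.
have /square_pencil_ker ker3 : xi0 = ('i%C * k) ^+ 2 by rewrite sqr_iM.
(* The constant entry 1 keeps each vector nonzero even if [kappay1], [kappay2] or [k] vanishes. *)
have x1_neq0 : col2 (- ('i%C * kappay1)) 1 != 0.
  by rewrite col2_neq0 ?oner_eq0 ?orbT.
have x2_neq0 : col2 (- ('i%C * kappay2)) 1 != 0.
  by rewrite col2_neq0 ?oner_eq0 ?orbT.
have x3_neq0 : col2 1 (- ('i%C * k)) != 0 by rewrite col2_neq0 ?oner_eq0.
split; last first.
  split=> //; exists (col2 (- ('i%C * kappay1)) 1).
  by exists (col2 (- ('i%C * kappay2)) 1), (col2 1 (- ('i%C * k))).
(* The type of the vector depends on [i]; finite choice assembles the dependent family from one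
   witness per index. *)
apply: (fin_all_exists (P := fun i x =>
  x != 0 /\ pencil_mx (tnth _ i) _ *m x = 0)) => -[[|[|[|[|//]]]] lti].
(* Writing the zero on the right as the known product leaves only an equality of matrices. *)
- exists phi; split=> //; rewrite -[RHS]ker0; congr (_ *m _).
  rewrite /pencil_mx !big_ord_recl big_ord0 !(tnth_nth 0) /=.
  by rewrite addr0 !addrA.
- exists (col2 (- ('i%C * kappay1)) 1); split=> //.
  rewrite -[RHS]ker1; congr (_ *m _).
  rewrite /pencil_mx !big_ord_recl big_ord0 !(tnth_nth 0) /=.
  by rewrite !scaler0 !add0r addr0 addrA.
- exists (col2 (- ('i%C * kappay2)) 1); split=> //.
  rewrite -[RHS]ker2; congr (_ *m _).
  rewrite /pencil_mx !big_ord_recl big_ord0 !(tnth_nth 0) /=.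
  by rewrite !scaler0 !add0r addr0 addrA.
- exists (col2 1 (- ('i%C * k))); split=> //.
  rewrite -[RHS]ker3; congr (_ *m _).
  rewrite /pencil_mx !big_ord_recl big_ord0 !(tnth_nth 0) /=.
  by rewrite !scaler0 !add0r addr0 addrA.
Qed.
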